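(* Let $\mathbb K$ be an algebraically closed field of characteristic zero, and let $V$ and $W$ be $\mathbb K[x,y]$-modules that are finite dimensional over $\mathbb K$. Let $L_V=\mathbb K\langle P,Q\rangle\rightthreetimes V$ and $L_W=\mathbb K\langle S,T\rangle\rightthreetimes W$ be their associated Lie algebras. Suppose that $L_V$ and $L_W$ are isomorphic as Lie algebras. Then one of the following conditions holds: (i) $V$ and $W$ are weakly isomorphic $\mathbb K[x,y]$-modules; (ii) $V=V_0\oplus V_2$ and $W=W_0\oplus W_2$ (direct sums of submodules), where $V_0$ and $W_0$ are submodules that are not weakly isomorphic and satisfy $\dim_{\mathbb K}V_0=\dim_{\mathbb K}W_0\le 6$, and where $V_2$ and $W_2$ are submodules of equal dimension on which $\mathbb K[x,y]$ acts trivially.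
   Context: Associated Lie algebra: for a $\mathbb K[x,y]$-module $V$, let $P,Q$ be the commuting linear operators $P(v)=x\cdot v$, $Q(v)=y\cdot v$ on $V$. The Lie algebra $L_V=\mathbb K\langle P,Q\rangle\rightthreetimes V$ associated with $V$ is the external semidirect product of the two-dimensional abelian Lie algebra with basis $P,Q$ (always two-dimensional, even if $P,Q$ are linearly dependent as operators) and the abelian Lie algebra $V$: as a vector space it is $\mathbb K\langle P,Q\rangle\oplus V$, with bracket $[P,Q]=0$, $[v,v']=0$, $[P,v]=P(v)$, $[Q,v]=Q(v)$ for $v,v'\in V$. Likewise $L_W=\mathbb K\langle S,T\rangle\rightthreetimes W$, with $S,T$ given by the actions of $x,y$ on $W$. Weak isomorphism: a linear automorphism $\theta$ of $\mathbb K[x,y]$ is a $\mathbb K$-algebra automorphism of the form $\theta(x)=\alpha_{11}x+\alpha_{12}y$, $\theta(y)=\alpha_{21}x+\alpha_{22}y$ with $[\alpha_{ij}]$ a nonsingular matrix over $\mathbb K$. The twisted module $V_\theta$ is the vector space $V$ with the action $x\circ v=\theta(x)\cdot v$, $y\circ v=\theta(y)\cdot v$. Modules $V$ and $W$ are weakly isomorphic if there is a finite sequence of $\mathbb K[x,y]$-modules $V_1=V,V_2,\dots,V_k=W$ such that for each $i=1,\dots,k-1$ either $V_i\simeq V_{i+1}$ or $V_{i+1}=(V_i)_{\theta_i}$ for some linear automorphism $\theta_i$. $\mathbb K[x,y]$ acts trivially on a module $U$ means $x\cdot u=y\cdot u=0$ for all $u\in U$. *)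

(* Defs.v *)
From HB Require Import structures.
From mathcomp Require Import all_boot all_order all_algebra.
From mathcomp Require Import mpoly.

Set Implicit Arguments.
Unset Strict Implicit.
Unset Printing Implicit Defensive.

Import GRing.Theory.
Local Open Scope ring_scope.

(* A {mpoly K[2]}-module structure is kept separate from the canonical         *)
(* lmodType structure, which on a vectType K is the one over K; fdmod_const    *)
(* says that the two scalar actions of K agree.                                *)
Record fdmod (K : fieldType) := Fdmod {
  fdmod_car :> vectType K;
  act : {mpoly K[2]} -> fdmod_car -> fdmod_car;
  fdmod_actDr : forall p u v, act p (u + v) = act p u + act p v;
  fdmod_actDl : forall p q v, act (p + q) v = act p v + act q v;
  fdmod_actM : forall p q v, act (p * q) v = act p (act q v);
  fdmod_act1 : forall v, act 1 v = v;
  fdmod_const : forall (c : K) v, act c%:MP v = c *: v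
}.
Arguments act {K f} p v.

Definition varx (K : fieldType) : {mpoly K[2]} := 'X_(@ord0 1).
Definition vary (K : fieldType) : {mpoly K[2]} := 'X_(@ord_max 1).

Definition mod_iso (K : fieldType) (V W : fdmod K) : Prop :=
  exists f : {linear V -> W},
    bijective f /\ forall (p : {mpoly K[2]}) (v : V), f (act p v) = act p (f v).

Definition linear_aut (K : fieldType)
    (theta : {lrmorphism {mpoly K[2]} -> {mpoly K[2]}}) : Prop :=
  bijective theta /\
  exists2 A : 'M[K]_2, A \in unitmx &
    forall i : 'I_2, theta 'X_i = \sum_(j < 2) A i j *: 'X_j.

Section Twist.
Variables (K : fieldType) (V : fdmod K).
Variable theta : {lrmorphism {mpoly K[2]} -> {mpoly K[2]}}.

Let tact (p : {mpoly K[2]}) (v : V) : V := act (theta p) v.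

Fact twist_actDr p u v : tact p (u + v) = tact p u + tact p v.
Proof. exact: fdmod_actDr. Qed.
Fact twist_actDl p q v : tact (p + q) v = tact p v + tact q v.
Proof. by rewrite /tact rmorphD fdmod_actDl. Qed.
Fact twist_actM p q v : tact (p * q) v = tact p (tact q v).
Proof. by rewrite /tact rmorphM fdmod_actM. Qed.
Fact twist_act1 v : tact 1 v = v.
Proof. by rewrite /tact rmorph1 fdmod_act1. Qed.
Fact twist_const (c : K) v : tact c%:MP v = c *: v.
Proof.
have cE : c%:MP = c *: 1 :> {mpoly K[2]} by rewrite -mul_mpolyC mulr1.
by rewrite /tact cE linearZ /= rmorph1 -cE fdmod_const.
Qed.

Definition twist : fdmod K :=
  Fdmod twist_actDr twist_actDl twist_actM twist_act1 twist_const.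

End Twist.

(* The Leibniz equality between modules loses nothing: it only has to hold for *)
(* the intermediate terms of a sequence, and isomorphisms are links as well.   *)
Definition weak_link (K : fieldType) (V W : fdmod K) : Prop :=
  mod_iso V W \/
  exists theta : {lrmorphism {mpoly K[2]} -> {mpoly K[2]}},
    linear_aut theta /\ W = twist V theta.

Definition weakly_iso (K : fieldType) (V W : fdmod K) : Prop :=
  exists (k : nat) (U : nat -> fdmod K),
    [/\ U 0%N = V, U k = W &
        forall i : nat, (i < k)%N -> weak_link (U i) (U i.+1)].

Record submodule (K : fieldType) (V : fdmod K) := Submodule {
  submodule_vs :> {vspace V};
  submodule_stable : forall (p : {mpoly K[2]}) (v : V),
    v \in submodule_vs -> act p v \in submodule_vs
}.

Section SubmoduleModule.
Variables (K : fieldType) (V : fdmod K) (U : submodule V).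

Let sact (p : {mpoly K[2]}) (u : subvs_of U) : subvs_of U :=
  vsproj U (act p (vsval u)).

(* vsproj is a projection of V onto U, but by stability it is only applied to  *)
(* vectors that already lie in U.                                              *)
Fact vsval_sact p u : vsval (sact p u) = act p (vsval u).
Proof. by rewrite /sact vsprojK // submodule_stable // subvsP. Qed.

Fact sub_actDr p u v : sact p (u + v) = sact p u + sact p v.
Proof.
by apply: val_inj; rewrite /= vsval_sact linearD fdmod_actDr -!vsval_sact.
Qed.
Fact sub_actDl p q v : sact (p + q) v = sact p v + sact q v.
Proof. by apply: val_inj; rewrite /= vsval_sact fdmod_actDl -!vsval_sact. Qed.
Fact sub_actM p q v : sact (p * q) v = sact p (sact q v).
Proof. by apply: val_inj; rewrite /= !vsval_sact fdmod_actM. Qed.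
Fact sub_act1 v : sact 1 v = v.
Proof. by apply: val_inj; rewrite /= vsval_sact fdmod_act1. Qed.
Fact sub_const (c : K) v : sact c%:MP v = c *: v.
Proof. by apply: val_inj; rewrite /= vsval_sact fdmod_const. Qed.

Definition submodule_fdmod : fdmod K :=
  Fdmod sub_actDr sub_actDl sub_actM sub_act1 sub_const.

End SubmoduleModule.

Definition acts_trivially (K : fieldType) (V : fdmod K) : Prop :=
  forall v : V, act (varx K) v = 0 /\ act (vary K) v = 0.

Record lieAlg (K : fieldType) := LieAlg {
  lie_car :> lmodType K;
  lie_br : lie_car -> lie_car -> lie_car;
  lie_linl : forall (c : K) a b d,
    lie_br (c *: a + b) d = c *: lie_br a d + lie_br b d;
  lie_linr : forall (c : K) a b d,
    lie_br d (c *: a + b) = c *: lie_br d a + lie_br d b;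
  lie_alt : forall a, lie_br a a = 0;
  lie_jacobi : forall a b c,
    lie_br a (lie_br b c) + lie_br b (lie_br c a) + lie_br c (lie_br a b) = 0
}.
Arguments lie_br {K l} a b.

Definition lie_iso (K : fieldType) (L M : lieAlg K) : Prop :=
  exists f : {linear L -> M},
    bijective f /\ forall a b : L, f (lie_br a b) = lie_br (f a) (f b).

Section AssocLie.
Variables (K : fieldType) (V : fdmod K).

Let Lcar := ('rV[K]_2 * V)%type.

(* The pair (a, v) stands for a_0 P + a_1 Q + v; using coordinate vectors for  *)
(* K<P, Q> keeps it two-dimensional even when P and Q are dependent operators. *)
Definition pq_op (a : 'rV[K]_2) (v : V) : V :=
  a 0 ord0 *: act (varx K) v + a 0 ord_max *: act (vary K) v.

Definition assoc_br (s t : Lcar) : Lcar :=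
  (0, pq_op s.1 t.2 - pq_op t.1 s.2).

Fact fdmod_actZ (p : {mpoly K[2]}) (c : K) (v : V) :
  act p (c *: v) = c *: act p v.
Proof. by rewrite -!fdmod_const -!fdmod_actM mulrC. Qed.

Fact pq_op_linr (a : 'rV[K]_2) (c : K) (u v : V) :
  pq_op a (c *: u + v) = c *: pq_op a u + pq_op a v.
Proof.
by rewrite /pq_op !fdmod_actDr !fdmod_actZ !scalerDr !scalerA
           ![_ * c]mulrC addrACA.
Qed.

Fact pq_op_linl (a b : 'rV[K]_2) (c : K) (v : V) :
  pq_op (c *: a + b) v = c *: pq_op a v + pq_op b v.
Proof. by rewrite /pq_op !mxE !scalerDl scalerDr !scalerA addrACA. Qed.

Fact pq_op0 (v : V) : pq_op 0 v = 0.
Proof. by rewrite /pq_op !mxE !scale0r addr0. Qed.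

Fact pq_opC (a b : 'rV[K]_2) (v : V) : pq_op a (pq_op b v) = pq_op b (pq_op a v).
Proof.
rewrite /pq_op !fdmod_actDr !fdmod_actZ !scalerDr !scalerA -!fdmod_actM.
rewrite [vary K * varx K]mulrC [LHS]addrACA.
by congr (_ *: _ + _ *: _ + (_ *: _ + _ *: _)); apply: mulrC.
Qed.

Fact pq_opB (a : 'rV[K]_2) (u v : V) : pq_op a (u - v) = pq_op a u - pq_op a v.
Proof. by rewrite addrC -scaleN1r pq_op_linr scaleN1r addrC. Qed.

Fact assoc_linl (c : K) (a b d : Lcar) :
  assoc_br (c *: a + b) d = c *: assoc_br a d + assoc_br b d.
Proof.
rewrite /assoc_br; congr pair; first by rewrite /= scaler0 addr0.
by rewrite /= pq_op_linl pq_op_linr scalerBr opprD addrACA.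
Qed.

Fact assoc_linr (c : K) (a b d : Lcar) :
  assoc_br d (c *: a + b) = c *: assoc_br d a + assoc_br d b.
Proof.
rewrite /assoc_br; congr pair; first by rewrite /= scaler0 addr0.
by rewrite /= pq_op_linl pq_op_linr scalerBr opprD addrACA.
Qed.

Fact assoc_alt (a : Lcar) : assoc_br a a = 0.
Proof. by rewrite /assoc_br subrr. Qed.

Fact assoc_jacobi (a b c : Lcar) :
  assoc_br a (assoc_br b c) + assoc_br b (assoc_br c a)
    + assoc_br c (assoc_br a b) = 0.
Proof.
rewrite /assoc_br /= !pq_op0 !subr0; congr pair; rewrite /= ?addr0 // !pq_opB.
rewrite (pq_opC b.1 a.1) (pq_opC c.1 a.1) (pq_opC c.1 b.1).
by rewrite [X in X + _]addrC !subrKA subrr.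
Qed.

Definition assoc_lie : lieAlg K :=
  LieAlg assoc_linl assoc_linr assoc_alt assoc_jacobi.

End AssocLie.

(* Main.v *)
(* Write the Lie isomorphism in blocks, f (a, v) = (al a + p v, q a + r v).
   - If p is onto, then L_W is the sum of its abelian ideals f(V) and W, so their
     intersection is central. It has codimension at most 2 in both, hence x and y
     act on V and on W with rank at most 2; as the span of their images has
     dimension at most 4, a trivial summand of codimension at most 6 splits off
     on each side. If the remaining summands are weakly isomorphic, so are V
     and W.
   - Otherwise the image of p lies in a line K s, and V and W are always weakly
     isomorphic. Pick b0 <> 0 with al b0 = c s. If c <> 0, correcting v by a
     multiple of b0 so that its image lies in W gives the isomorphism. If c = 0,
     the preimage of (s, 0) has the form (e b0, y) with p y = s, and one corrects
     v by multiples of b0 and y instead; that s commutes with the rest of the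
     complement of W provides the second intertwining relation. *)

Require Import Defs.
From HB Require Import structures.
From mathcomp Require Import all_boot all_order all_algebra.
From mathcomp Require Import mpoly zify ring.
From Stdlib Require Import Classical.

Set Implicit Arguments.
Unset Strict Implicit.
Unset Printing Implicit Defensive.

Import GRing.Theory.
Local Open Scope ring_scope.

(** * Linear substitutions in the polynomial ring *)

Lemma mpoly_ring_ind (R : comNzRingType) (n : nat) (P : {mpoly R[n]} -> Prop) :
  (forall c, P c%:MP) -> (forall i, P 'X_i) ->
  (forall p q, P p -> P q -> P (p + q)) ->
  (forall p q, P p -> P q -> P (p * q)) -> forall p, P p.
Proof.
move=> PC PX PD PM; elim/mpolyind=> [|c m p _ _ Pp]; first by rewrite -mpolyC0.
apply: (PD) => //; rewrite -mul_mpolyC; apply: (PM) => //.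
rewrite mpolyXE_id; apply: (big_ind P) => [||i _].
- by rewrite -mpolyC1.
- exact: PM.
- elim: (m i) => [|k IHk]; first by rewrite expr0 -mpolyC1.
  by rewrite exprS; apply: (PM).
Qed.

Section LinearSubstitution.
Variable K : fieldType.

Definition linsubst (A : 'M[K]_2) : {lrmorphism {mpoly K[2]} -> {mpoly K[2]}} :=
  comp_mpoly [tuple \sum_(j < 2) A i j *: 'X_j | i < 2].

Lemma linsubstX A i : linsubst A 'X_i = \sum_(j < 2) A i j *: 'X_j.
Proof. by rewrite /= comp_mpolyXU -tnth_nth tnth_mktuple. Qed.

(** Row [i] of a matrix holds the coefficients of the image of ['X_i], so substituting [A] and then
    [B] amounts to the product [A *m B]. *)
Lemma linsubstK A B : A *m B = 1%:M -> cancel (linsubst A) (linsubst B).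
Proof.
move=> AB1; elim/mpoly_ring_ind => [c|i|p q pK qK|p q pK qK].
- by rewrite /= !comp_mpolyC.
- rewrite linsubstX linear_sum /=.
  under eq_bigr => j _ do rewrite linearZ /= linsubstX scaler_sumr.
  rewrite exchange_big /=.
  under eq_bigr => k _.
    under eq_bigr => j _ do rewrite scalerA.
    rewrite -scaler_suml.
    have -> : \sum_(j < 2) A i j * B j k = (i == k)%:R.
      by move/matrixP/(_ i k): AB1; rewrite !mxE.
    over.
  rewrite (bigD1 i) //= eqxx scale1r big1 ?addr0 // => k.
  by rewrite eq_sym => /negPf->; rewrite scale0r.
- by rewrite !rmorphD /= pK qK.
- by rewrite !rmorphM /= pK qK.
Qed.

Lemma linear_aut_linsubst A : A \in unitmx -> linear_aut (linsubst A).
Proof.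
move=> uA; split; last by exists A => // i; apply: linsubstX.
by exists (linsubst (invmx A)); apply: linsubstK; rewrite ?mulmxV ?mulVmx.
Qed.

End LinearSubstitution.

(** * Weak isomorphism as a single intertwining relation *)

Section WeakIso.
Variable K : fieldType.
Implicit Types V W : fdmod K.

Lemma act_scale V c (p : {mpoly K[2]}) (v : V) : act (c *: p) v = c *: act p v.
Proof. by rewrite -mul_mpolyC fdmod_actM fdmod_const. Qed.

Lemma pq_opE V (a : 'rV[K]_2) (v : V) :
  pq_op a v = act (\sum_(j < 2) a 0 j *: 'X_j) v.
Proof.
rewrite big_ord_recl big_ord1 fdmod_actDl !act_scale /pq_op /varx /vary.
by congr (_ + a 0 _ *: act 'X_ _ v); apply/val_inj.
Qed.

Lemma act_varE V (i : 'I_2) (v : V) : act 'X_i v = pq_op (delta_mx 0 i) v.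
Proof.
rewrite pq_opE (bigD1 i) //= mxE !eqxx scale1r big1 ?addr0 // => j ji.
by rewrite mxE (negPf ji) andbF scale0r.
Qed.

Lemma act_morph V W (f : {linear V -> W}) :
  (forall i v, f (act 'X_i v) = act 'X_i (f v)) ->
  forall p v, f (act p v) = act p (f v).
Proof.
move=> fX; elim/mpoly_ring_ind => [c|i|p q pK qK|p q pK qK] v //.
- by rewrite !fdmod_const linearZ.
- by rewrite !fdmod_actDl linearD pK qK.
- by rewrite !fdmod_actM pK qK.
Qed.

(** The working form of weak isomorphism: a whole sequence of links is collapsed into one linear
    bijection and one change of basis of the plane spanned by the two operators. *)
Definition pq_equiv V W : Prop :=
  exists (f : {linear V -> W}) (A : 'M[K]_2),
    [/\ bijective f, A \in unitmx &
        forall a v, f (pq_op a v) = pq_op (a *m A) (f v)].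

Lemma pq_op_twist V (theta : {lrmorphism {mpoly K[2]} -> {mpoly K[2]}})
    (A : 'M[K]_2) (a : 'rV[K]_2) (v : twist V theta) :
  (forall i : 'I_2, theta 'X_i = \sum_(j < 2) A i j *: 'X_j) ->
  pq_op a v = pq_op (a *m A) (v : V).
Proof.
move=> thetaX; rewrite !pq_opE /= linear_sum /=; congr (act _ _).
under eq_bigr => i _ do rewrite linearZ /= thetaX scaler_sumr.
rewrite exchange_big /=; apply: eq_bigr => j _.
by rewrite mxE scaler_suml; apply: eq_bigr => i _; rewrite scalerA.
Qed.

Lemma pq_equiv_trans U V W : pq_equiv U V -> pq_equiv V W -> pq_equiv U W.
Proof.
move=> [f [A [bf uA fE]]] [g [B [bg uB gE]]]; exists (g \o f), (A *m B).
split; [exact: bij_comp | by rewrite unitmx_mul uA uB | move=> a v /=].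
by rewrite fE gE mulmxA.
Qed.

(** Along a sequence, an isomorphism contributes the identity matrix and a twist the identity map
    with an inverse matrix; these compose. Conversely, one twist followed by one isomorphism is
    enough. *)
Lemma weakly_isoP V W : weakly_iso V W <-> pq_equiv V W.
Proof.
split=> [[k [U [<- <- linkU]]] | [f [A [bf uA fE]]]]; last first.
  pose theta := linsubst (invmx A).
  (* The term at index 2 is [W], the default value of [nth]. *)
  exists 2%N, (nth W [:: V; twist V theta]); split=> // -[|[|//]] _ /=.
    right; exists theta; split=> //; apply: linear_aut_linsubst.
    by rewrite unitmx_inv.
  left; exists (f : {linear twist V theta -> W}); split=> //.
  apply: act_morph => i v; rewrite !act_varE.
  rewrite (pq_op_twist (A := invmx A)); last exact: linsubstX.
  by rewrite fE mulmxKV.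
elim: k linkU => [_ | k IHk linkU].
  exists (idfun : {linear U 0%N -> U 0%N}), 1%:M.
  split; [by exists id | exact: unitmx1 | by move=> a v; rewrite mulmx1].
apply: pq_equiv_trans (IHk _) _ => [i ik|]; first exact/linkU/ltnW.
case: (linkU k (ltnSn k)) => [[f [bf fE]] | [theta [[_ [A uA thetaX]] ->]]].
  by exists f, 1%:M; split=> // [|a v]; rewrite ?unitmx1 // mulmx1 !pq_opE fE.
exists (idfun : {linear U k -> twist (U k) theta}), (invmx A).
split=> [||a v]; [by exists id | by rewrite unitmx_inv|].
by rewrite (pq_op_twist (A := A)) // mulmxKV.
Qed.

End WeakIso.

(** * Dimension arguments for linear maps and subspaces *)

Section LinearBijection.
Variables (K : fieldType) (aT rT : vectType K) (f : {linear aT -> rT}).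
Hypothesis dim_eq : \dim {:aT} = \dim {:rT}.

Lemma inj_linear_bij : injective f -> bijective f.
Proof.
move=> injf; have kf0 : lker (linfun f) == 0%VS.
  by apply/lker0P => u v; rewrite !lfunE => /injf.
have limgf : limg (linfun f) = fullv.
  by apply/eqP; rewrite eqEdim subvf limg_dim_eq ?dim_eq //= (eqP kf0) capv0.
exists (linfun f)^-1%VF => u; first by rewrite -[f u]lfunE lker0_lfunK.
by rewrite -[LHS]lfunE limg_lfunVK // limgf memvf.
Qed.

Lemma surj_linear_bij : (forall w, exists v, f v = w) -> bijective f.
Proof.
move=> surjf; apply: inj_linear_bij => u v fuv.
have limgf : limg (linfun f) = fullv.
  apply/vspaceP => w; rewrite memvf; have [x <-] := surjf w.
  by rewrite -lfunE memv_img ?memvf.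
have /eqP := limg_ker_dim (linfun f) fullv.
rewrite limgf -dim_eq -[X in _ == X]add0n eqn_add2r dimv_eq0 capfv.
by move/lker0P; apply; rewrite !lfunE.
Qed.

End LinearBijection.

Lemma subspace_of_dim (K : fieldType) (vT : vectType K) (U : {vspace vT})
    (m : nat) :
  (m <= \dim U)%N -> exists2 U' : {vspace vT}, (U' <= U)%VS & \dim U' = m.
Proof.
move=> mU; pose X := take m (vbasis U).
have freeX : free X.
  have := basis_free (vbasisP U); rewrite -(cat_take_drop m (vbasis U)).
  exact: catl_free.
exists <<X>>%VS; last by rewrite (eqP freeX) size_takel ?size_tuple.
by apply/span_subvP => u /mem_take; apply: vbasis_mem.
Qed.

(** * Splitting off and putting back trivial summands *)

Section TrivialSummand.
Variables (K : fieldType) (V : fdmod K).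

Fact act_is_linear (p : {mpoly K[2]}) : linear (act p : V -> V).
Proof. by move=> c u v; rewrite fdmod_actDr fdmod_actZ. Qed.
HB.instance Definition _ p :=
  GRing.isLinear.Build K V V *:%R (act p) (act_is_linear p).

Fact pq_op_is_linear (a : 'rV[K]_2) : linear (pq_op a : V -> V).
Proof. by move=> c u v; rewrite pq_op_linr. Qed.
HB.instance Definition _ a :=
  GRing.isLinear.Build K V V *:%R (pq_op a) (pq_op_is_linear a).

Lemma act_stable (U : {vspace V}) :
  (forall i v, v \in U -> act 'X_i v \in U) ->
  forall p v, v \in U -> act p v \in U.
Proof.
move=> UX; elim/mpoly_ring_ind => [c|i|p q pK qK|p q pK qK] v vU.
- by rewrite fdmod_const rpredZ.
- exact: UX.
- by rewrite fdmod_actDl rpredD ?pK ?qK.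
- by rewrite fdmod_actM; apply/pK/qK.
Qed.

Lemma vsval_act (U : submodule V) (p : {mpoly K[2]}) (u : submodule_fdmod U) :
  vsval (act p u) = act p (vsval u) :> V.
Proof. exact: vsval_sact. Qed.

(** The dimension [m] is left free so that two modules can be given trivial summands of the same
    size; by truncated subtraction it is 0 when [V] has dimension at most 6. *)
Lemma trivial_summand (Z : {vspace V}) (m : nat) :
  (forall i v, v \in Z -> act 'X_i v = 0) ->
  (\dim {:V} <= \dim Z + 2)%N -> (m <= \dim {:V} - 6)%N ->
  exists V0 V2 : submodule V,
    [/\ (V0 + V2)%VS = fullv, directv (V0 + V2), \dim V2 = m &
        acts_trivially (submodule_fdmod V2)].
Proof.
move=> Z0 dimZ mV.
pose im i := limg (linfun (act ('X_i : {mpoly K[2]}) : V -> V)).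
have dim_im i : (\dim (im i) <= 2)%N.
  have sZker : (Z <= lker (linfun (act ('X_i : {mpoly K[2]}) : V -> V)))%VS.
    by apply/subvP => v vZ; rewrite memv_ker lfunE /= Z0.
  have := limg_ker_dim (linfun (act ('X_i : {mpoly K[2]}) : V -> V)) fullv.
  rewrite capfv -/(im i) => dimE; rewrite -(leq_add2l (\dim Z)).
  by apply: leq_trans dimZ; rewrite -dimE leq_add2r dimvS.
pose I := (im ord0 + im ord_max)%VS.
have dimI : (\dim I <= 4)%N.
  by apply: leq_trans (dimv_add_leqif _ _) _;
    apply: (leq_add (dim_im _) (dim_im _)).
have actI i v : act 'X_i v \in I.
  have im_i : act 'X_i v \in im i by rewrite -[act _ v]lfunE memv_img ?memvf.
  apply: subvP im_i; have [->|->] : i = ord0 \/ i = ord_max.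
    by case: i => -[|[|//]] h; [left|right]; apply: val_inj.
  - exact: addvSl.
  - exact: addvSr.
(* Since [Z] meets [I] in dimension at most 4, the complement of [Z :&: I] in [Z] has dimension at
   least [\dim Z - 4], hence at least [\dim {:V} - 6]. *)
have [|V2 sV2 dimV2] := @subspace_of_dim _ _ (Z :\: I)%VS m.
  have := dimv_cap_compl Z I; have := dimvS (capvSr Z I).
  move: dimZ dimI mV; move: (\dim {:V}) (\dim Z) (\dim I) => n z k.
  move: (\dim (Z :&: I)) (\dim (Z :\: I)) => c d; lia.
have capI2 : (I :&: V2 = 0)%VS.
  apply/eqP; rewrite -subv0 -(capv_diff Z I) capvC subv_cap capvSr.
  by rewrite (subv_trans (capvSl _ _)).
(* Any subspace containing [I] is stable, because both variables map all of [V] into [I]. *)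
pose V0 := (I + (I + V2)^C)%VS.
have V0_stable p v : v \in V0 -> act p v \in V0.
  by apply: act_stable => i u _; apply: subvP (actI i u); apply: addvSl.
have V2_triv i v : v \in V2 -> act 'X_i v = 0.
  by move=> vV2; apply: Z0; apply: subvP vV2;
    apply: subv_trans sV2 (diffvSl _ _).
have V2_stable p v : v \in V2 -> act p v \in V2.
  by apply: act_stable => i u uV2; rewrite V2_triv ?mem0v.
have V02 : (V0 + V2)%VS = fullv.
  by rewrite /V0 -addvA [(_^C + _)%VS]addvC addvA addv_complf.
exists (Submodule V0_stable), (Submodule V2_stable); split=> //=.
  rewrite directvEgeq /= V02.
  have := dimv_add_leqif I (I + V2)^C => -[+ _].
  rewrite dimv_compl (dimv_disjoint_sum capI2) -/V0.
  have := dimvS (subvf (I + V2)); rewrite (dimv_disjoint_sum capI2).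
  move: (\dim V0) (\dim V2) (\dim I) (\dim {:V}) => a b c d; lia.
by move=> v; split; apply: val_inj;
  rewrite [LHS]vsval_act linear0 V2_triv ?subvsP.
Qed.

Lemma pq_op_trivial (U : submodule V) (a : 'rV[K]_2) v :
  acts_trivially (submodule_fdmod U) -> v \in (U : {vspace V}) -> pq_op a v = 0.
Proof.
move=> trivU vU; have [x0 y0] := trivU (vsproj U v).
have act0_of p : act p (vsproj U v : submodule_fdmod U) = 0 -> act p v = 0.
  by move=> /(congr1 vsval); rewrite vsval_act linear0 vsprojK.
by rewrite /pq_op !act0_of ?scaler0 ?addr0.
Qed.

Lemma vsval_pq_op (U : submodule V) (a : 'rV[K]_2) (u : submodule_fdmod U) :
  vsval (pq_op a u) = pq_op a (vsval u) :> V.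
Proof. by rewrite !pq_opE [LHS]vsval_act. Qed.

End TrivialSummand.

(** On the trivial summands both sides of the intertwining relation vanish, whatever the matrix, so
    any linear bijection between them extends [f0]. *)
Lemma pq_equiv_add_trivial (K : fieldType) (V W : fdmod K)
    (V0 V2 : submodule V) (W0 W2 : submodule W) :
  (V0 + V2)%VS = fullv -> directv (V0 + V2) ->
  (W0 + W2)%VS = fullv -> directv (W0 + W2) ->
  \dim V0 = \dim W0 -> \dim V2 = \dim W2 ->
  acts_trivially (submodule_fdmod V2) -> acts_trivially (submodule_fdmod W2) ->
  pq_equiv (submodule_fdmod V0) (submodule_fdmod W0) -> pq_equiv V W.
Proof.
move=> V02 dV W02 dW dim0 dim2 trivV trivW [f0 [A [bf0 uA f0E]]].
have dimVW : \dim {:V} = \dim {:W}.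
  by rewrite -V02 -W02 (directvP dV) (directvP dW) /= dim0 dim2.
move/directv_addP: (dV) => capV.
have [f2 f2E] := linear_of_free (vbasis V2) (vbasis W2).
have {}f2E : (linfun f2 @: V2 = W2)%VS.
  rewrite -(span_basis (vbasisP V2)) limg_span.
  rewrite (eq_map (lfunE f2)) f2E ?size_tuple ?dim2 //.
    exact: (span_basis (vbasisP W2)).
  exact: (basis_free (vbasisP V2)).
pose g0 : {linear V -> W} :=
  (vsval : submodule_fdmod W0 -> W) \o f0 \o
    (vsproj V0 : V -> submodule_fdmod V0) \o daddv_pi V0 V2.
pose g : {linear V -> W} := g0 \+ (f2 \o daddv_pi V2 V0).
have pi0 v : v \in (V0 : {vspace V}) -> daddv_pi V2 V0 v = 0.
  move=> vV0; have := daddv_pi_add (w := v) capV; rewrite V02 memvf => /(_ isT).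
  by rewrite daddv_pi_id // => vE; apply: (addrI v); rewrite vE addr0.
have pi2 v : v \in (V2 : {vspace V}) -> daddv_pi V0 V2 v = 0.
  move=> vV2; have := daddv_pi_add (w := v) capV; rewrite V02 memvf => /(_ isT).
  rewrite [X in _ + X]daddv_pi_id // 1?capvC // => vE.
  by apply: (addIr v); rewrite vE add0r.
have gV0 v : v \in (V0 : {vspace V}) -> g v = vsval (f0 (vsproj V0 v)).
  by move=> vV0; rewrite /g /= pi0 // linear0 addr0 daddv_pi_id.
have gV2 v : v \in (V2 : {vspace V}) -> g v = f2 v.
  by move=> vV2; rewrite /g /= pi2 // !linear0 add0r daddv_pi_id // capvC.
have split_mem (v : V) :
    exists2 v0, v0 \in (V0 : {vspace V}) &
      exists2 v2, v2 \in (V2 : {vspace V}) & v = v0 + v2.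
  by apply/memv_addP; rewrite V02 memvf.
clearbody g; exists g, A; split=> //.
- apply: surj_linear_bij => // w.
  have /memv_addP[w0 w0W [w2 w2W ->]] : w \in (W0 + W2)%VS by rewrite W02 memvf.
  have [h _ hK] := bf0.
  move: w2W; rewrite -f2E => /memv_imgP[v2 v2V ->].
  exists (vsval (h (vsproj W0 w0)) + v2).
  rewrite linearD gV0 ?subvsP // gV2 // vsvalK hK vsprojK //.
  by rewrite lfunE.
- move=> a v; have [v0 v0V [v2 v2V ->]] := split_mem v.
  rewrite [pq_op a (v0 + v2)]linearD /= (pq_op_trivial a trivV v2V) addr0.
  rewrite [g (v0 + v2)]linearD [in RHS]linearD /=.
  have f2v2 : f2 v2 \in (W2 : {vspace W}) by rewrite -f2E -lfunE memv_img.
  rewrite (gV2 v2) // (pq_op_trivial _ trivW f2v2).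
  have -> : pq_op a v0 = vsval (pq_op a (vsproj V0 v0 : submodule_fdmod V0)).
    by rewrite vsval_pq_op vsprojK.
  by rewrite addr0 gV0 ?subvsP // gV0 // vsvalK f0E vsval_pq_op.
Qed.

(** * The determinant form on the plane *)

Section PlaneDeterminant.
Variable K : fieldType.
Implicit Types a b x : 'rV[K]_2.

Definition det2 a b : K := a 0 ord0 * b 0 ord_max - a 0 ord_max * b 0 ord0.

Fact det2_is_scalar a : scalar (det2 a).
Proof. by move=> c x y; rewrite /det2 !mxE /=; ring. Qed.
HB.instance Definition _ a :=
  GRing.isLinear.Build K 'rV[K]_2 K *%R (det2 a) (det2_is_scalar a).

Lemma det2C a b : det2 a b = - det2 b a.
Proof. by rewrite /det2; ring. Qed.

Lemma det2Zl c a b : det2 (c *: a) b = c * det2 a b.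
Proof. by rewrite det2C linearZ /= -mulrN -det2C. Qed.

Lemma det2xx a : det2 a a = 0.
Proof. by rewrite /det2; ring. Qed.

Lemma row2P (x y : 'rV[K]_2) :
  x 0 ord0 = y 0 ord0 -> x 0 ord_max = y 0 ord_max -> x = y.
Proof.
move=> xy0 xy1; apply/rowP => -[[|[|//]] h].
  by have -> : Ordinal h = ord0 by apply: val_inj.
by have -> : Ordinal h = ord_max by apply: val_inj.
Qed.

Lemma det2_colinear a x : a != 0 -> det2 a x = 0 -> exists c, x = c *: a.
Proof.
move=> a0 /eqP; rewrite subr_eq0 => /eqP dax.
have [a00|a00] := eqVneq (a 0 ord0) 0; last first.
  exists (x 0 ord0 / a 0 ord0); apply: row2P; rewrite !mxE ?divfK //.
  by rewrite mulrAC [x _ _ * _]mulrC -dax mulrAC divff // mul1r.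
have a01 : a 0 ord_max != 0.
  by apply: contraNneq a0 => a01; apply/eqP/row2P; rewrite mxE.
exists (x 0 ord_max / a 0 ord_max); apply: row2P; rewrite !mxE ?divfK //.
by rewrite mulrAC [x _ _ * _]mulrC dax mulrAC divff // mul1r.
Qed.

Lemma det2_neq0 a : a != 0 -> exists x, det2 a x != 0.
Proof.
move=> a0; apply: NNPP => det0; case/eqP: a0; apply: row2P; rewrite mxE;
  apply/eqP/negPn/negP => ai; case: det0.
- by exists (delta_mx 0 ord_max); rewrite /det2 !mxE /= mulr1 mulr0 subr0.
- by exists (delta_mx 0 ord0); rewrite /det2 !mxE /= mulr1 mulr0 sub0r oppr_eq0.
Qed.

(** The determinant form is nondegenerate, hence identifies the plane with its dual. *)
Lemma scalar_det2 (k : {scalar 'rV[K]_2}) : exists a, det2 a =1 k.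
Proof.
exists (\row_j
  if j == ord0 then k (delta_mx 0 ord_max) else - k (delta_mx 0 ord0)).
move=> x; rewrite [x in RHS]row_sum_delta linear_sum big_ord_recl big_ord1.
have -> : lift ord0 ord0 = ord_max :> 'I_2 by apply: val_inj.
by rewrite !linearZ /det2 !mxE /=; ring.
Qed.

(** By linearity the intertwining relation need only be checked on a basis [a], [b]; the matrix is
    the one taking it to the basis [s], [t]. *)
Lemma pq_equiv_bases (V W : fdmod K) (f : {linear V -> W}) a b s t :
  bijective f -> det2 a b != 0 -> det2 s t != 0 ->
  (forall v, f (pq_op a v) = pq_op s (f v)) ->
  (forall v, f (pq_op b v) = pq_op t (f v)) -> pq_equiv V W.
Proof.
pose M (x y : 'rV[K]_2) : 'M[K]_2 :=
  \matrix_(i, j) (if i == ord0 then x else y) 0 j.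
have uM x y : det2 x y != 0 -> M x y \in unitmx.
  have detM : \det (M x y) = det2 x y.
    rewrite (expand_det_row _ ord0) big_ord_recl big_ord1 /cofactor !det_mx11.
    rewrite !mxE /= /det2.
    have -> : lift ord0 ord0 = ord_max :> 'I_2 by apply: val_inj.
    have -> : lift ord_max 0 = ord0 :> 'I_2 by apply: val_inj.
    by rewrite expr0 mul1r expr1 mulN1r mulrN.
  by rewrite unitmxE detM unitfE.
have pqM (U : fdmod K) x y z (u : U) :
    pq_op (z *m M x y) u = z 0 ord0 *: pq_op x u + z 0 ord_max *: pq_op y u.
  have -> : z *m M x y = z 0 ord0 *: x + z 0 ord_max *: y.
    have e : lift ord0 ord0 = ord_max :> 'I_2 by apply: val_inj.
    by apply: row2P; rewrite !mxE big_ord_recl big_ord1 !mxE e.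
  by rewrite pq_op_linl -[_ *: y]addr0 pq_op_linl pq_op0 addr0.
move=> bf ab st fa fb; exists f, (invmx (M a b) *m M s t).
split=> // [|x v]; first by rewrite unitmx_mul unitmx_inv !uM.
by rewrite -{1}[x](mulmxKV (uM _ _ ab)) mulmxA !pqM linearD !linearZ /= fa fb.
Qed.

End PlaneDeterminant.

(** * Block form of linear maps between products *)

Section PairInjections.
Variables (K : fieldType) (U V : lmodType K).

Definition pair_inl (u : U) : U * V := (u, 0).
Definition pair_inr (v : V) : U * V := (0, v).

Fact pair_inl_is_linear : linear pair_inl.
Proof. by move=> c u v; congr pair; rewrite /= scaler0 addr0. Qed.
HB.instance Definition _ :=
  GRing.isLinear.Build K U (U * V)%type *:%R pair_inl pair_inl_is_linear.

Fact pair_inr_is_linear : linear pair_inr.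
Proof. by move=> c u v; congr pair; rewrite /= scaler0 addr0. Qed.
HB.instance Definition _ :=
  GRing.isLinear.Build K V (U * V)%type *:%R pair_inr pair_inr_is_linear.

End PairInjections.

Lemma linear_blocks (K : fieldType) (U V U' V' : lmodType K)
    (f : {linear (U * V)%type -> (U' * V')%type}) :
  exists (al : {linear U -> U'}) (p : {linear V -> U'})
         (q : {linear U -> V'}) (r : {linear V -> V'}),
    forall u v, f (u, v) = (al u + p v, q u + r v).
Proof.
exists (fst \o f \o @pair_inl K U V), (fst \o f \o @pair_inr K U V).
exists (snd \o f \o @pair_inl K U V), (snd \o f \o @pair_inr K U V) => u v.
have -> : (u, v) = pair_inl V u + pair_inr U v.
  by congr pair; rewrite /= ?addr0 ?add0r.
by rewrite linearD; congr pair.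
Qed.

(** * Consequences of a Lie isomorphism in block form *)

Section LieIsomorphism.
Variables (K : fieldType) (V W : fdmod K).
Variable f : {linear ('rV[K]_2 * V)%type -> ('rV[K]_2 * W)%type}.
Hypothesis bij_f : bijective f.
Hypothesis f_br : forall x y, f (assoc_br x y) = assoc_br (f x) (f y).
Variables (al : {linear 'rV[K]_2 -> 'rV[K]_2}) (p : {linear V -> 'rV[K]_2}).
Variables (q : {linear 'rV[K]_2 -> W}) (r : {linear V -> W}).
Hypothesis lie_isoE : forall a v, f (a, v) = (al a + p v, q a + r v).

Lemma lie_iso_dim : \dim {:V} = \dim {:W}.
Proof.
have kf0 : lker (linfun f) == 0%VS.
  by apply/lker0P => u v; rewrite !lfunE => /(bij_inj bij_f).
have limgf : limg (linfun f) = fullv.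
  apply/vspaceP => w; rewrite memvf; have [g _ fK] := bij_f.
  by rewrite -(fK w) -lfunE memv_img ?memvf.
have := limg_dim_eq (f := linfun f) (U := fullv); rewrite (eqP kf0) capv0.
rewrite limgf => /(_ erefl); rewrite !dimvf.
by move=> /(@addnI 2) ->.
Qed.

(** The images of two vectors of the abelian ideal [V] commute. *)
Lemma lie_iso_ann v v' : pq_op (p v) (r v') = pq_op (p v') (r v).
Proof.
have := f_br (0, v) (0, v').
rewrite {1}/assoc_br /= !pq_op0 subrr !lie_isoE !linear0 !add0r.
by move=> /(congr1 snd) /esym /eqP; rewrite /= subr_eq0 => /eqP.
Qed.

(** The image of a bracket is a bracket in the target, so it has no component outside [W]. *)
Lemma lie_iso_br a v :
  p (pq_op a v) = 0 /\ r (pq_op a v) = pq_op (al a) (r v) - pq_op (p v) (q a).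
Proof.
have := f_br (a, 0) (0, v).
rewrite {1}/assoc_br /= pq_op0 subr0 !lie_isoE !linear0 !add0r !addr0.
by case=> -> ->.
Qed.

Lemma lie_iso_inj a v : al a + p v = 0 -> q a + r v = 0 -> a = 0 /\ v = 0.
Proof.
move=> ap0 qr0; have : f (a, v) = f 0 by rewrite lie_isoE ap0 qr0 linear0.
by move=> /(bij_inj bij_f) [].
Qed.

Lemma lie_iso_surj s w : exists a v, al a + p v = s /\ q a + r v = w.
Proof.
have [g _ fK] := bij_f; exists (g (s, w)).1, (g (s, w)).2.
by have := fK (s, w); case: (g _) => a v /=; rewrite lie_isoE => -[].
Qed.

(** The witnesses are [ker p], which is the part of [V] sent into [W], and its image under [r]; [r]
    is injective on [ker p] because [f] is. *)
Lemma lie_iso_abelian_sum :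
  (forall s, exists v, p v = s) ->
  exists (ZV : {vspace V}) (ZW : {vspace W}),
    [/\ (forall i v, v \in ZV -> act 'X_i v = 0),
        (forall i w, w \in ZW -> act 'X_i w = 0),
        (\dim {:V} <= \dim ZV + 2)%N & (\dim {:W} <= \dim ZW + 2)%N].
Proof.
move=> surj_p; pose ZV := lker (linfun p).
have ZVE v : v \in ZV -> p v = 0 by rewrite memv_ker lfunE => /eqP.
(* Writing [a] as [p v'], the commutation of images gives [a . r v = p v . r v'], which is 0. *)
have rZV a v : v \in ZV -> pq_op a (r v) = 0.
  have [v' <-] := surj_p a; move=> /ZVE pv.
  by rewrite lie_iso_ann pv pq_op0.
have dimZV : (\dim {:V} <= \dim ZV + 2)%N.
  have := limg_ker_dim (linfun p) fullv; rewrite capfv => <-.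
  by rewrite leq_add2l (leq_trans (dimvS (subvf _))) // dimvf.
exists ZV, (linfun r @: ZV)%VS; split=> //.
- move=> i v vZ; rewrite act_varE; have [px rx] := lie_iso_br (delta_mx 0 i) v.
  have [||_ ->] // := @lie_iso_inj 0 (pq_op (delta_mx 0 i) v).
    by rewrite linear0 px addr0.
  by rewrite rx linear0 rZV // (ZVE v vZ) pq_op0 subrr addr0.
- move=> i _ /memv_imgP[v vZ ->].
  by rewrite act_varE lfunE rZV.
- rewrite limg_dim_eq -?lie_iso_dim //.
  apply/eqP; rewrite -subv0; apply/subvP => v; rewrite memv_cap memv0.
  case/andP=> /ZVE pv; rewrite memv_ker lfunE => /eqP rv.
  by have [||_ ->] // := @lie_iso_inj 0 v; rewrite ?pv ?rv linear0 addr0.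
Qed.

(* The isomorphism is [F v], the second component of [f (k v *: b, v - k v *: y)];
   the first component vanishes. If [x . y + b . z = 0], bracketing this element
   with [f (x, z)], whose first component is [t], gives [F (x . v) = t . F v]. *)
Lemma lie_iso_shear (k : {scalar V}) s b y x1 z1 x2 z2 :
  (forall v, p v = k v *: s) -> s != 0 -> b != 0 -> al b + s = p y ->
  pq_op x1 y + pq_op b z1 = 0 -> pq_op x2 y + pq_op b z2 = 0 ->
  det2 x1 x2 != 0 -> det2 (al x1 + p z1) (al x2 + p z2) != 0 ->
  pq_equiv V W.
Proof.
move=> pE s0 b0 bE xz1 xz2 dx dt.
pose F v := q (k v *: b) + r (v - k v *: y).
have F_lin : linear F.
  move=> c u v; rewrite /F linearP /= !scalerDl -!scalerA linearP /=.
  have -> : c *: u + v - (c *: (k u *: y) + k v *: y)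
              = c *: (u - k u *: y) + (v - k v *: y).
    by rewrite scalerBr opprD addrACA.
  by rewrite linearP /= scalerDr addrACA.
pose FL : {linear V -> W} :=
  HB.pack F (GRing.isLinear.Build K V W *:%R F F_lin).
have FE v : f (k v *: b, v - k v *: y) = (0, F v).
  rewrite lie_isoE; congr pair; rewrite linearZ linearB linearZ /= -bE pE.
  by rewrite scalerDr addrA subrr.
have FX x z v : pq_op x y + pq_op b z = 0 ->
    FL (pq_op x v) = pq_op (al x + p z) (FL v).
  move=> xz; have := f_br (x, z) (k v *: b, v - k v *: y).
  rewrite FE [f (x, z)]lie_isoE [in RHS]/assoc_br /= pq_op0 subr0.
  move=> /(congr1 snd) /= <-; rewrite lie_isoE /= linear0 add0r.
  rewrite /FL /= /F.
  (* Since [p] kills brackets, no correction is applied to [pq_op x v]. *)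
  have -> : k (pq_op x v) = 0.
    have [/eqP + _] := lie_iso_br x v.
    by rewrite pE scaler_eq0 (negPf s0) orbF => /eqP.
  rewrite !scale0r linear0 subr0 add0r; congr (r _).
  rewrite pq_opB linearZ -[k v *: b]addr0 pq_op_linl pq_op0 addr0 /=.
  by rewrite -addrA -opprD -scalerDr xz scaler0 subr0.
apply: (pq_equiv_bases (f := FL)) dx dt (FX _ _ ^~ xz1) (FX _ _ ^~ xz2).
apply: inj_linear_bij; first exact: lie_iso_dim.
move=> u v /eqP; rewrite -subr_eq0 -linearB => /eqP Fuv.
have /(bij_inj bij_f)[] : f (k (u - v) *: b, u - v - k (u - v) *: y) = f 0.
  by rewrite FE [F _]Fuv linear0.
move=> /eqP; rewrite scaler_eq0 (negPf b0) orbF => /eqP ->.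
by rewrite scale0r subr0 => /eqP; rewrite subr_eq0 => /eqP.
Qed.

Lemma lie_iso_collinear s :
  s != 0 -> (forall v, det2 s (p v) = 0) -> pq_equiv V W.
Proof.
move=> s0 ps0; have [t st] := det2_neq0 s0.
(* The coefficient of [p v] along [s], read off by pairing with the transversal vector [t]. *)
pose k0 v := (det2 t s)^-1 * det2 t (p v).
have k_lin : scalar k0.
  by move=> c u v; rewrite /k0 !linearP /= mulrDr mulrCA.
pose k : {scalar V} := HB.pack k0 (GRing.isLinear.Build K V K *%R k0 k_lin).
have pE v : p v = k v *: s.
  have [c pv] := det2_colinear s0 (ps0 v).
  rewrite /k /= /k0 pv linearZ /= mulrCA mulVf ?mulr1 //.
  by rewrite det2C oppr_eq0.
(* The line through [b0] is the set of vectors that [al] sends into the line of [s]. *)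
have [b0 b0E] := scalar_det2 (det2 s \o al : {scalar 'rV[K]_2}).
have [a [v [av _]]] := lie_iso_surj t 0.
have b0a : det2 b0 a != 0 
  by have -> : det2 b0 a = det2 s t by rewrite b0E -av linearD /= ps0 addr0.
have b00 : b0 != 0.
  by apply: contraNneq b0a => ->; rewrite /det2 !mxE !mul0r subrr.
have [c cE] : exists c, al b0 = c *: s.
  by apply: det2_colinear => //; rewrite -[LHS]b0E det2xx.
have [c0|c0] := eqVneq c 0; last first.
  (* Here [al] sends [- c^-1 *: b0] to [- s], so [y = 0] works, and the two relations hold trivially
     for the pairs [(b0, 0)] and [(a, 0)]. *)
  apply: (@lie_iso_shear k s (- c^-1 *: b0) 0 b0 0 a 0);
    rewrite ?linear0 ?addr0 //.
  - by rewrite scaler_eq0 oppr_eq0 invr_eq0 (negPf c0).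
  - by rewrite linearZ cE /= scalerA mulNr mulVf // scaleN1r addNr.
  - by rewrite cE det2Zl mulf_neq0 // -[det2 _ _]b0E.
have {}cE : al b0 = 0 by rewrite cE c0 scale0r.
have [b' [y [by_s by_0]]] := lie_iso_surj s 0.
have [e b'E] : exists e, b' = e *: b0.
  apply: det2_colinear => //.
  by rewrite b0E /= -(addrK (p y) (al b')) by_s linearB /= det2xx ps0 subrr.
have py : p y = s by rewrite -by_s b'E linearZ cE /= scaler0 add0r.
have [x [z [xz_t xz_0]]] := lie_iso_surj t 0.
have sx : det2 s (al x) = det2 s t by rewrite -xz_t linearD /= ps0 addr0.
(* The elements [(s, 0)] and [(t, 0)] commute, hence so do their preimages [(b', y)] and
   [(x, z)]. *)
have xy : pq_op x y - pq_op b' z = 0.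
  have := f_br (x, z) (b', y).
  rewrite {1}/assoc_br /= !lie_isoE by_s by_0 xz_t xz_0.
  rewrite /assoc_br /= !linear0 !add0r => -[_ rxy].
  have [||_ ->] // := @lie_iso_inj 0 (pq_op x y - pq_op b' z).
    rewrite linear0 add0r linearB /=.
    by rewrite !(proj1 (lie_iso_br _ _)) subr0.
  by rewrite linear0 add0r.
(* The first pair [(b0, - y)] has image with first component [- s] and satisfies its relation by
   cancellation; for the second pair the relation is [xy], as [b' = e *: b0]. *)
apply: (@lie_iso_shear k s b0 y b0 (- y) x (- (e *: z))) => //.
- by rewrite cE add0r py.
- by rewrite linearN subrr.
- rewrite -[RHS]xy b'E linearN linearZ -[e *: b0]addr0 pq_op_linl pq_op0 addr0.
  by [].
- by rewrite b0E /= sx.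
- rewrite cE linearN py add0r -scaleN1r det2Zl mulN1r oppr_eq0 linearD /= sx.
  by rewrite linearN linearZ /= linearN linearZ /= ps0 mulr0 subr0.
Qed.

End LieIsomorphism.

(** * Case distinction on the rank of [p] and conclusion *)

Lemma lin_rank_dichotomy (K : fieldType) (V : vectType K)
    (p : {linear V -> 'rV[K]_2}) :
  (forall t, exists v, p v = t) \/
  (exists2 s, s != 0 & forall v, det2 s (p v) = 0).
Proof.
have [[v1 [v2 /eqP d12]]|nd] :=
    classic (exists v1 v2, det2 (p v1) (p v2) <> 0); [left => t | right].
  (* Cramer's rule for [t] in the basis [p v1], [p v2]. *)
  exists ((det2 t (p v2) / det2 (p v1) (p v2)) *: v1
            + (det2 (p v1) t / det2 (p v1) (p v2)) *: v2).
  rewrite linearD !linearZ /=; move: (p v1) (p v2) d12 => a b.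
  by rewrite /det2 => dab; apply: row2P; rewrite !mxE; field.
have [[v /eqP pv0]|p0] := classic (exists v, p v <> 0).
  by exists (p v) => // u; apply: NNPP => duv; case: nd; exists v, u.
(* Here [p] is zero and any nonzero vector would do. *)
exists (delta_mx 0 ord0) => [|v].
  by apply/eqP => /rowP/(_ ord0)/eqP; rewrite !mxE oner_eq0.
have -> : p v = 0 by apply: NNPP => pv; case: p0; exists v.
by rewrite linear0.
Qed.

Theorem theorem1 (K : closedFieldType) (char0 : [pchar K] =i pred0)
    (V W : fdmod K) (isoLVLW : lie_iso (assoc_lie V) (assoc_lie W)) :
  weakly_iso V W \/
  exists (V0 V2 : submodule V) (W0 W2 : submodule W),
    [/\ (V0 + V2)%VS = fullv /\ directv (V0 + V2),
        (W0 + W2)%VS = fullv /\ directv (W0 + W2),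
        ~ weakly_iso (submodule_fdmod V0) (submodule_fdmod W0),
        \dim V0 = \dim W0 /\ (\dim V0 <= 6)%N &
        \dim V2 = \dim W2 /\
        (acts_trivially (submodule_fdmod V2) /\
         acts_trivially (submodule_fdmod W2))].
Proof.
have [f [bij_f f_br]] := isoLVLW.
have [al [p [q [r fE]]]] :=
  linear_blocks (f : {linear ('rV[K]_2 * V)%type -> ('rV[K]_2 * W)%type}).
have [p_surj|[s s0 ps0]] := lin_rank_dichotomy p; last first.
  by left; apply/weakly_isoP; exact: (lie_iso_collinear bij_f f_br fE s0 ps0).
have dimVW := lie_iso_dim bij_f.
have [ZV [ZW [ZV0 ZW0 dimZV dimZW]]] :=
  lie_iso_abelian_sum bij_f f_br fE p_surj.
have [V0 [V2 [V02 dV dimV2 trivV]]] := trivial_summand ZV0 dimZV (leqnn _).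
(* Both trivial summands get dimension [\dim {:V} - 6], so the remaining ones have equal dimension,
   at most 6. *)
have := leqnn (\dim {:V} - 6); rewrite {2}dimVW => mW.
have [W0 [W2 [W02 dW dimW2 trivW]]] := trivial_summand ZW0 dimZW mW.
have dimV : (\dim V0 + \dim V2 = \dim {:V})%N by rewrite -V02 (directvP dV).
have dimW : (\dim W0 + \dim W2 = \dim {:W})%N by rewrite -W02 (directvP dW).
have dim2 : \dim V2 = \dim W2 by rewrite dimV2.
have dim0 : \dim V0 = \dim W0.
  by apply: (@addIn (\dim V2)); rewrite dimV dim2 dimW.
have [/weakly_isoP iso0|niso0] :=
    classic (weakly_iso (submodule_fdmod V0) (submodule_fdmod W0)).
  left; apply/weakly_isoP.
  exact: pq_equiv_add_trivial V02 dV W02 dW dim0 dim2 trivV trivW iso0.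
right; exists V0, V2, W0, W2; split=> //; split=> //.
by rewrite -(leq_add2r (\dim V2)) dimV dimV2 -leq_subLR.
Qed.
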